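(* Let $F,G\in\mathbb{R}^{m\times m}$ with $\det F=0$ and with $sF-G$ a regular pencil, and consider the system $FY_{k+1}=GY_k$, $k=0,1,2,\dots$, with non-consistent initial conditions $Y_0\in\mathbb{R}^m$. Let $Q_p$ and $J_p$ be the matrices obtained from the Weierstrass canonical form of the pencil, and for each non-consistent $Y_0$ let the optimal solution be $$\hat Y_k=Q_pJ_p^k(Q_p^*Q_p)^{-1}Q_p^*Y_0,\qquad k\ge 0.$$ Let $E$ be the set of equilibrium states of the system and let $Y_*\in E$. Then $Y_*$ is stable in the sense of Lyapunov if and only if there exists a constant $c\in(0,+\infty)$ such that $\|J_p^k\|\le c<+\infty$ for all $k\ge 0$.
   Context: The pencil $sF-G$ is regular if $\det(sF-G)$ is not identically zero as a polynomial in $s\in\mathbb{C}$. Its finite eigenvalues are the roots $s\in\mathbb{C}$ of $\det(sF-G)$; $p$ is the number of them counted with algebraic multiplicity, and $q=m-p$ is the algebraic multiplicity of the infinite eigenvalue. Weierstrass canonical form: by regularity there are non-singular matrices $P,Q\in\mathbb{C}^{m\times m}$ such that $$PFQ=\begin{bmatrix} I_p&0_{p,q}\\0_{q,p}&H_q\end{bmatrix},\qquad PGQ=\begin{bmatrix} J_p&0_{p,q}\\0_{q,p}&I_q\end{bmatrix},$$ where $H_q$ is nilpotent and $J_p$ is a $p\times p$ Jordan matrix whose eigenvalues are the finite eigenvalues of the pencil. Such $P,Q$ are fixed, and $Q$ is partitioned as $Q=[\,Q_p\ \ Q_q\,]$ with $Q_p$ of size $m\times p$ and $Q_q$ of size $m\times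 q$. Here $^*$ denotes conjugate transpose and $\|\cdot\|$ a fixed vector norm or its induced matrix norm. An initial condition $Y_0\in\mathbb{R}^m$ is consistent if the system has a solution $(Y_k)_{k\ge0}$ starting at $Y_0$; equivalently, $Y_0\in\mathrm{colspan}\,Q_p$. It is non-consistent otherwise, i.e. if $Y_0\notin\mathrm{colspan}\,Q_p$. For non-consistent $Y_0$, the optimal solution $\hat Y_k$ is the solution of the system starting at the consistent vector $\hat Y_0$ that minimizes $\|Y_0-\hat Y_0\|_2$; it is given by the formula in the claim. A vector $Y_*\in\mathbb{R}^m$ is an equilibrium state if it is a consistent initial condition and $Y_0=Y_*$ implies $Y_k=Y_*$ for all $k\ge1$. $E$ denotes the set of all equilibrium states. An equilibrium state $Y_*$ is stable in the sense of Lyapunov (with respect to the optimal solutions) if for every $\epsilon>0$ there is $\delta(\epsilon)>0$ such that for every non-consistent initial condition $Y_0\in\mathbb{R}^m$, $\|Y_0-Y_*\|\le\delta(\epsilon)$ implies $\|\hat Y_k-Y_*\|\le\epsilon$ for all $k\ge0$. *)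

(* Defs.v *)
From mathcomp Require Import all_boot all_order all_algebra.
From mathcomp Require Import spectral complex.
From mathcomp Require Import classical_sets reals.

Set Implicit Arguments.
Unset Strict Implicit.
Unset Printing Implicit Defensive.

Import Order.TTheory GRing.Theory Num.Theory.
Local Open Scope ring_scope.
Local Open Scope complex_scope.
Local Open Scope sesquilinear_scope.
Local Open Scope classical_set_scope.

Definition cplx_mx (R : realType) m n (A : 'M[R]_(m, n)) : 'M[R[i]]_(m, n) :=
  map_mx (real_complex R) A.

Section Pencil.
Variables (R : realType) (m : nat) (F G : 'M[R]_m).

Definition pencil_det : {poly R[i]} :=
  \det ('X *: map_mx polyC (cplx_mx F) - map_mx polyC (cplx_mx G)).

Definition regular_pencil : Prop := pencil_det != 0.

(* For a regular pencil, the roots of [pencil_det] listed with multiplicity. *)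
Definition finite_eigenvalues : seq R[i] :=
  sval (closed_field_poly_normal pencil_det).

End Pencil.

Definition jordan_block (K : nzRingType) (a : K) (n : nat) : 'M[K]_n :=
  \matrix_(i < n, j < n) (a *+ (i == j) + (i.+1 == j :> nat)%:R).

Definition jordan_matrix (K : nzRingType) (n : nat) (J : 'M[K]_n) : Prop :=
  exists (r : nat) (a : 'I_r -> K) (s : 'I_r -> nat)
         (e : (\sum_(i < r) s i)%N = n),
    J = castmx (e, e) (\mxdiag_(i < r) jordan_block (a i) (s i)).

Definition nilpotent_mx (K : nzRingType) (n : nat) (H : 'M[K]_n) : Prop :=
  exists k : nat, H ^+ k = 0.

Record weierstrass_form (R : realType) (m p q : nat) (e : (p + q)%N = m)
    (F G : 'M[R]_m) (P Q : 'M[R[i]]_m) (J : 'M[R[i]]_p) (H : 'M[R[i]]_q) :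
    Prop := WeierstrassForm {
  wf_size : p = size (finite_eigenvalues F G);
  wf_unitP : P \in unitmx;
  wf_unitQ : Q \in unitmx;
  wf_F : P *m cplx_mx F *m Q = castmx (e, e) (block_mx 1%:M 0 0 H);
  wf_G : P *m cplx_mx G *m Q = castmx (e, e) (block_mx J 0 0 1%:M);
  wf_nilp : nilpotent_mx H;
  wf_jordan : jordan_matrix J;
  wf_eigen : forall z : R[i], eigenvalue J z = (z \in finite_eigenvalues F G)
}.

Definition left_block (K : Type) (m p q : nat) (e : (p + q)%N = m)
    (Q : 'M[K]_m) : 'M[K]_(m, p) :=
  lsubmx (castmx (erefl m, esym e) Q).

Section Dynamics.
Variables (R : realType) (m : nat) (F G : 'M[R]_m).

Definition solution (Y : nat -> 'cV[R]_m) : Prop :=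
  forall k : nat, F *m Y k.+1 = G *m Y k.

Definition consistent (Y0 : 'cV[R]_m) : Prop :=
  exists2 Y : nat -> 'cV[R]_m, solution Y & Y 0%N = Y0.

Definition equilibria : set 'cV[R]_m :=
  [set Ys | consistent Ys /\
    forall Y : nat -> 'cV[R]_m, solution Y -> Y 0%N = Ys ->
      forall k : nat, (1 <= k)%N -> Y k = Ys].

End Dynamics.

Section Norms.
Variable R : realType.

Definition vector_norm (n : nat) (N : 'cV[R[i]]_n -> R) : Prop :=
  [/\ forall v, N v = 0 -> v = 0,
      forall (a : R[i]) v, (N (a *: v))%:C = `|a| * (N v)%:C
    & forall v w, N (v + w) <= N v + N w].

(* The supremum is over the unit ball rather than the unit sphere, so that it
   is also correct (equal to 0) when n = 0. *)
Definition induced_norm (n : nat) (N : 'cV[R[i]]_n -> R) (A : 'M[R[i]]_n) : R :=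
  sup [set N (A *m v) | v in [set v | N v <= 1]].

End Norms.

Section OptimalSolutions.
Variables (R : realType) (m p : nat).
Variables (F G : 'M[R]_m) (Qp : 'M[R[i]]_(m, p)) (J : 'M[R[i]]_p).

Definition optimal_solution (Y0 : 'cV[R]_m) (k : nat) : 'cV[R[i]]_m :=
  Qp *m J ^+ k *m invmx (Qp ^t* *m Qp) *m Qp ^t* *m cplx_mx Y0.

Definition lyapunov_stable (N : 'cV[R[i]]_m -> R) (Ys : 'cV[R]_m) : Prop :=
  forall eps : R, 0 < eps -> exists2 delta : R, 0 < delta &
    forall Y0 : 'cV[R]_m, ~ consistent F G Y0 ->
      N (cplx_mx (Y0 - Ys)) <= delta ->
      forall k : nat, N (optimal_solution Y0 k - cplx_mx Ys) <= eps.

End OptimalSolutions.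

(* Main.v *)
Require Import Defs.
From mathcomp Require Import all_boot all_order all_algebra.
From mathcomp Require Import spectral complex.
From mathcomp Require Import boolp classical_sets filter reals.
From mathcomp Require Import topology normedtype derive.
From mathcomp Require Import lra.

Set Implicit Arguments.
Unset Strict Implicit.
Unset Printing Implicit Defensive.

Import Order.TTheory GRing.Theory Num.Theory.
Import numFieldNormedType.Exports.
Local Open Scope ring_scope.
Local Open Scope complex_scope.
Local Open Scope sesquilinear_scope.
Local Open Scope classical_set_scope.

(** Why the theorem holds.  Write S for (Qp^* Qp)^-1 Qp^*, a left inverse of Qp.
    The optimal solution from Y0 is Qp J^k S Y0, and Qp J^k S fixes the
    equilibrium Ys, so the deviation from Ys at time k is Qp J^k S (Y0 - Ys)
    ([optimal_solution_consistent]: on a consistent initial condition the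
    formula returns the true solution, here the constant Ys).  Stability is
    therefore a statement about the linear maps Qp J^k S alone.

    If the J^k are bounded, so are the maps Qp J^k S, uniformly in k, and
    stability is immediate.

    Conversely, stability with eps = 1 bounds the sequence Qp J^k S X for each
    non-consistent real X: scale X until Ys + t X lies within delta of Ys; that
    vector is still non-consistent.  Since F is singular the infinite block is
    nonempty, so non-consistent vectors exist ([nonconsistent_exists]), and as
    the complement of a proper subspace they span: every real vector is a
    difference of two of them ([nonconsistent_span]).  Taking real and imaginary
    parts, the sequence is bounded for every complex vector, in particular for
    every Qp v, where S Qp v = v.  Undoing Qp, the sequence J^k v is bounded for
    each v, and in finite dimension pointwise boundedness is uniform
    boundedness ([pointwise_bounded_uniform]).

    The norms being arbitrary, all estimates rest on the fact that coordinates
    are bounded by any norm ([vnorm_coord]), obtained by minimizing the norm on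
    the compact unit sphere of the underlying real space. *)

(** * Norms on real row vectors *)

Section RealNorm.
Variables (R : realType) (d : nat) (M : 'rV[R]_d -> R).
Hypothesis M_eq0 : forall x, M x = 0 -> x = 0.
Hypothesis MZ : forall (t : R) x, M (t *: x) = `|t| * M x.
Hypothesis MD : forall x y, M (x + y) <= M x + M y.

Lemma rnorm0 : M 0 = 0.
Proof. by rewrite -(scale0r 0) MZ normr0 mul0r. Qed.

Lemma rnorm_ge0 x : 0 <= M x.
Proof.
have := MD x (-1 *: x); rewrite scaleN1r subrr rnorm0 -scaleN1r MZ normrN1 mul1r.
by rewrite -mulr2n pmulrn_lge0.
Qed.

(** Expand on the canonical basis; this Lipschitz bound makes the norm
    continuous. *)
Lemma rnorm_le_mx_norm : exists2 C, 0 < C & forall x, M x <= C * `|x|.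
Proof.
pose S := \sum_(j < d) M (delta_mx 0 j).
have S_ge0 : 0 <= S by apply: sumr_ge0 => j _; exact: rnorm_ge0.
exists (1 + S) => [|x]; first by rewrite ltr_pwDl.
apply: (@le_trans _ _ (S * `|x|)); last by rewrite ler_wpM2r// lerDr.
rewrite {1}(row_sum_delta x) mulr_suml.
elim/big_ind2: _ => [|x1 x2 y1 y2 h1 h2|j _]; first by rewrite rnorm0.
  by rewrite (le_trans (MD _ _))// lerD.
rewrite MZ mulrC ler_wpM2l ?rnorm_ge0//.
rewrite [`|x|]mx_normrE.
exact: (le_bigmax _ (fun ij => `|x ij.1 ij.2|) (0, j)).
Qed.

Lemma rnorm_continuous : continuous M.
Proof.
have [C C0 MC] := rnorm_le_mx_norm.
have MB x y : M x - M y <= C * `|x - y|.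
  by rewrite lerBlDr (le_trans _ (lerD (MC (x - y)) (lexx _)))// -{1}(subrK y x).
move=> x; apply/(@cvgrPdist_le _ _ _ (nbhs x)) => e e0; near=> y.
apply: (@le_trans _ _ (C * `|x - y|)).
  by rewrite ler_norml MB andbT lerNl opprB distrC MB.
rewrite -ler_pdivlMl// mulrC.
near: y.
have /(@cvgrPdist_le _ _ _ (nbhs x)) : (id @ x --> x) by exact: cvg_id.
by apply; rewrite divr_gt0.
Unshelve. all: by end_near. Qed.

(** The norm attains a minimum on the compact unit sphere of the sup norm, and
    definiteness makes this minimum positive. *)
Lemma mx_norm_le_rnorm : exists2 c, 0 < c & forall x, c * `|x| <= M x.
Proof.
pose S := [set x : 'rV[R]_d | `|x| = 1].
have normS x : x != 0 -> S (`|x|^-1 *: x).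
  by move=> x0; rewrite /S/= normrZ normfV normr_id mulVf// normr_eq0.
(* The sphere is empty exactly in dimension zero, where any constant works. *)
have [S0|Se] := pselect (S !=set0); last first.
  exists 1 => // x; have [->|/normS xS] := eqVneq x 0.
    by rewrite normr0 mulr0 rnorm0.
  by case: Se; exists (`|x|^-1 *: x).
have Sc : compact S.
  apply: bounded_closed_compact.
    by exists 1; split => // r r1 x /= ->; exact: ltW.
  apply: (@closed_comp _ _ (fun x : 'rV[R]_d => `|x|) [set 1]).
    by move=> x _; exact: norm_continuous.
  exact/accessible_closed_set1/hausdorff_accessible/Rhausdorff.
have [|x0 x0S x0min] := EVT_min_rV S0 Sc (f := M).
  apply: continuous_subspaceT; exact: rnorm_continuous.
have Mx0 : 0 < M x0.
  rewrite lt_neqAle rnorm_ge0 andbT eq_sym; apply/eqP => /M_eq0 x00.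
  by move: x0S; rewrite inE /S/= x00 normr0 => /eqP; rewrite eq_sym oner_eq0.
exists (M x0) => // x; have [->|xn0] := eqVneq x 0.
  by rewrite normr0 mulr0 rnorm0.
have nx : 0 < `|x| by rewrite normr_gt0.
have := x0min _ (mem_set (normS _ xn0)).
by rewrite MZ normfV normr_id mulrC ler_pdivlMr.
Qed.

End RealNorm.

(** * Norms on complex column vectors *)

Section ComplexNorm.
Variable R : realType.
Local Notation normc := ComplexField.Normc.normc.

Section OneNorm.
Variables (n : nat) (N : 'cV[R[i]]_n -> R).
Hypothesis normN : vector_norm N.

Lemma vnormZ a v : N (a *: v) = normc a * N v.
Proof.
case: normN => _ NZ _; have := NZ a v; rewrite -[`|a|]/((normc a)%:C).
by rewrite -rmorphM => /complexI.
Qed.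

Lemma vnormZr (t : R) v : N (t%:C *: v) = `|t| * N v.
Proof. by rewrite vnormZ /= expr0n/= addr0 sqrtr_sqr. Qed.

Lemma vnorm0 : N 0 = 0.
Proof. by rewrite -(scale0r 0) vnormZr normr0 mul0r. Qed.

Lemma vnormD v w : N (v + w) <= N v + N w.
Proof. by case: normN. Qed.

Lemma vnormN v : N (- v) = N v.
Proof. by rewrite -scaleN1r -(rmorphN1 (real_complex R)) vnormZr normrN1 mul1r. Qed.

Lemma vnorm_ge0 v : 0 <= N v.
Proof.
by have := vnormD v (- v); rewrite subrr vnorm0 vnormN -mulr2n pmulrn_lge0.
Qed.

Lemma vnorm_eq0 v : N v = 0 -> v = 0.
Proof. by case: normN => + _ _; apply. Qed.

(** Restricting scalars to the reals identifies C^n with R^(n + n), whose unit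
    sphere is compact; the lower bound for real norms then controls real and
    imaginary parts separately. *)
Lemma vnorm_coord : exists2 C, 0 < C & forall (v : 'cV_n) j, normc (v j 0) <= C * N v.
Proof.
pose psi (x : 'rV[R]_(n + n)) : 'cV[R[i]]_n :=
  \col_j (x 0 (lshift n j) +i* x 0 (rshift n j)).
have psiE x j : psi x j 0 = x 0 (lshift n j) +i* x 0 (rshift n j).
  by rewrite mxE.
have psiZ t x : psi (t *: x) = t%:C *: psi x.
  apply/colP => j; rewrite !mxE; apply/eqP.
  by rewrite eq_complex /= !mul0r subr0 addr0 !eqxx.
have psiD x y : psi (x + y) = psi x + psi y.
  by apply/colP => j; rewrite !mxE.
have psi_eq0 x : psi x = 0 -> x = 0.
  move=> x0; apply/rowP => k; rewrite mxE.
  have [j ->|j ->] := split_ordP k.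
    by have := psiE x j; rewrite x0 mxE => -[].
  by have := psiE x j; rewrite x0 mxE => -[].
have [|||c c0 cM] := @mx_norm_le_rnorm R (n + n) (N \o psi).
- by move=> x /= /vnorm_eq0/psi_eq0.
- by move=> t x; rewrite /= psiZ vnormZr.
- by move=> x y; rewrite /= psiD vnormD.
exists (2 / c) => [|v j]; first by rewrite divr_gt0.
pose x : 'rV[R]_(n + n) :=
  row_mx (\row_k complex.Re (v k 0)) (\row_k complex.Im (v k 0)).
have xv : psi x = v.
  apply/colP => k; rewrite psiE row_mxEl row_mxEr !mxE.
  by case: (v k 0).
have xle k : `|x 0 k| <= `|x|.
  rewrite [`|x|]mx_normrE.
  exact: (le_bigmax _ (fun ij => `|x ij.1 ij.2|) (0, k)).
apply: (@le_trans _ _ (2 * `|x|)); last first.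
  rewrite -mulrA ler_pM2l// ler_pdivlMl//.
  by have := cM x; rewrite /= xv.
have := xle (lshift n j); have := xle (rshift n j).
rewrite row_mxEl row_mxEr !mxE; case: (v j 0) => a b /= hb ha.
apply: (@le_trans _ _ (`|a| + `|b|)); last by lra.
rewrite -[leRHS]ger0_norm ?addr_ge0// -(sqrtr_sqr (_ + _)) ler_wsqrtr//.
rewrite -(real_normK (num_real a)) -(real_normK (num_real b)) sqrrD.
by rewrite addrAC lerDl mulrn_wge0// mulr_ge0.
Qed.

End OneNorm.

(** Uniform boundedness in finite dimension: it suffices to bound the family on
    the canonical basis, because the norm controls the coordinates. *)
Lemma pointwise_bounded_uniform (n m : nat) (N1 : 'cV[R[i]]_n -> R)
    (N2 : 'cV[R[i]]_m -> R) (I : Type) (A : I -> 'M[R[i]]_(m, n)) :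
  vector_norm N1 -> vector_norm N2 ->
  (forall v, exists B, forall i, N2 (A i *m v) <= B) ->
  exists2 C, 0 < C & forall i v, N2 (A i *m v) <= C * N1 v.
Proof.
move=> n1 n2 bnd.
have /fin_all_exists[B HB] (j : 'I_n) :
    exists B : R, forall i, N2 (A i *m delta_mx j 0) <= B by exact: bnd.
have [C C0 HC] := vnorm_coord n1.
pose S := \sum_(j < n) `|B j|.
have S_ge0 : 0 <= S by exact: sumr_ge0.
exists (C * (1 + S)) => [|i v]; first by rewrite mulr_gt0// ltr_pwDl.
apply: (@le_trans _ _ (C * S * N1 v)); last first.
  by rewrite ler_wpM2r ?vnorm_ge0// ler_pM2l// lerDr.
rewrite mulrAC mulr_sumr.
have -> : A i *m v = \sum_(j < n) v j 0 *: (A i *m delta_mx j 0).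
  under eq_bigr do rewrite scalemxAr.
  rewrite -mulmx_sumr; congr (_ *m _).
  rewrite {1}[v]matrix_sum_delta; apply: eq_bigr => j _.
  by rewrite big_ord1.
elim/big_ind2: _ => [|x1 x2 y1 y2 h1 h2|j _]; first by rewrite vnorm0.
  by rewrite (le_trans (vnormD _ _ _))// lerD.
rewrite vnormZ// ler_pM ?vnorm_ge0//.
  by case: (v j 0) => a b; exact: sqrtr_ge0.
exact: le_trans (HB _ _) (ler_norm _).
Qed.

Lemma mulmx_bounded (n m : nat) (N1 : 'cV[R[i]]_n -> R)
    (N2 : 'cV[R[i]]_m -> R) (A : 'M[R[i]]_(m, n)) :
  vector_norm N1 -> vector_norm N2 ->
  exists2 C, 0 < C & forall v, N2 (A *m v) <= C * N1 v.
Proof.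
move=> n1 n2.
have [|C C0 HC] := pointwise_bounded_uniform (A := fun _ : unit => A) n1 n2.
  by move=> v; exists (N2 (A *m v)).
by exists C => // v; exact: (HC tt).
Qed.

Lemma induced_norm_le n (N : 'cV[R[i]]_n -> R) (A : 'M[R[i]]_n) c :
  vector_norm N -> 0 <= c -> (forall v, N (A *m v) <= c * N v) ->
  induced_norm N A <= c.
Proof.
move=> nN c0 Ac; apply: ge_sup.
  by exists (N (A *m 0)), 0 => //=; rewrite vnorm0.
move=> _ [v /= v1 <-]; rewrite (le_trans (Ac v))//.
by rewrite -[leRHS]mulr1 ler_wpM2l.
Qed.

(** Boundedness of linear maps is what makes the supremum defining the induced
    norm a genuine one, rather than the default value of [sup]. *)
Lemma le_induced_norm n (N : 'cV[R[i]]_n -> R) (A : 'M[R[i]]_n) v :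
  vector_norm N -> N (A *m v) <= induced_norm N A * N v.
Proof.
move=> nN; have [C C0 HC] := mulmx_bounded A nN nN.
have [Nv0|Nv] := eqVneq (N v) 0.
  by rewrite Nv0 mulr0 (vnorm_eq0 nN Nv0) mulmx0 vnorm0.
have Nvp : 0 < N v by rewrite lt_neqAle eq_sym Nv vnorm_ge0.
rewrite -ler_pdivrMr//; apply: ub_le_sup.
  exists C => _ [w /= w1 <-]; rewrite (le_trans (HC w))//.
  by rewrite -[leRHS]mulr1 ler_wpM2l// ltW.
exists ((N v)^-1%:C *: v) => /=.
  by rewrite vnormZr// gtr0_norm ?invr_gt0// mulVf.
by rewrite -scalemxAr vnormZr// gtr0_norm ?invr_gt0// mulrC.
Qed.

End ComplexNorm.

(** * The projection onto the column span *)

(** If u A^* A = 0 then the row vector u A^* has zero Hermitian square, hence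
    vanishes; a left inverse of A makes A^* cancellable. *)
Lemma gram_unitmx (C : numClosedFieldType) (m p : nat) (A : 'M[C]_(m, p))
    (B : 'M[C]_(p, m)) : B *m A = 1%:M -> A ^t* *m A \in unitmx.
Proof.
move=> BA; rewrite -row_free_unit -kermx_eq0; apply/rowV0P => u /sub_kermxP uAA.
have uA0 : u *m A ^t* = 0.
  have /eqP : dotmx (u *m A ^t*) (u *m A ^t*) = 0.
    by rewrite dotmxE trmx_mul map_mxM trmxCK mulmxA -(mulmxA u) uAA mul0mx mxE.
  by rewrite dnorm_eq0 => /eqP.
have ABt : A ^t* *m B ^t* = 1%:M by rewrite -map_mxM -trmx_mul BA trmx1 map_mx1.
by rewrite -(mulmx1 u) -ABt mulmxA uA0 mul0mx.
Qed.

(** * The system in Weierstrass coordinates *)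

Section WeierstrassDynamics.
Variables (R : realType) (m p q : nat) (e : (p + q)%N = m).
Variables (F G : 'M[R]_m) (P Q : 'M[R[i]]_m).
Variables (J : 'M[R[i]]_p) (H : 'M[R[i]]_q).
Hypothesis wf : weierstrass_form e F G P Q J H.
Let Qp := left_block e Q.

(** The row blocks Lp, Lq of Q^-1 read off the finite and infinite coordinates
    of a state; in them the recurrence F y' = G y decouples. *)
Lemma weierstrass_coordinates :
  exists Lp : 'M_(p, m), exists Lq : 'M_(q, m), exists Qq : 'M_(m, q),
  [/\ Lp *m Qp = 1%:M, Lq *m Qq = 1%:M, Qp *m Lp + Qq *m Lq = 1%:M &
      forall y y' : 'cV[R[i]]_m, cplx_mx F *m y' = cplx_mx G *m y ->
        Lp *m y' = J *m (Lp *m y) /\ H *m (Lq *m y') = Lq *m y].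
Proof.
rewrite /Qp; clear Qp; destruct e.
have Qu := wf_unitQ wf; have := wf_F wf; have := wf_G wf.
rewrite !castmx_id /left_block castmx_id => PGQ PFQ.
pose V := invmx Q.
have VQ : V *m Q = 1%:M by rewrite mulVmx.
have QV : Q *m V = 1%:M by rewrite mulmxV.
exists (usubmx V), (dsubmx V), (rsubmx Q).
have : V *m Q = block_mx (usubmx V *m lsubmx Q) (usubmx V *m rsubmx Q)
   (dsubmx V *m lsubmx Q) (dsubmx V *m rsubmx Q).
  by rewrite -mul_col_row vsubmxK hsubmxK.
rewrite VQ scalar_mx_block => /eq_block_mx[pp _ _ qq]; split => //.
  by rewrite -mul_row_col vsubmxK hsubmxK QV scalar_mx_block.
move=> y y' Fy.
have : P *m cplx_mx F *m Q *m (V *m y') = P *m cplx_mx G *m Q *m (V *m y).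
  rewrite !mulmxA -(mulmxA _ Q V) QV mulmx1 -(mulmxA _ Q V) QV mulmx1.
  by rewrite -!mulmxA Fy.
rewrite PFQ PGQ -{1 2}[V]vsubmxK !mul_col_mx !mul_row_col !mul0mx !mul1mx.
by rewrite !add0r !addr0 => /eq_col_mx.
Qed.

(** The infinite coordinates obey z_k = H z_(k+1), so z_k = H^h z_(k+h) vanishes
    once H^h = 0: solutions live in the column span of Qp, where they are
    driven by J. *)
Lemma solution_coordinates :
  exists Lp : 'M_(p, m), exists Lq : 'M_(q, m), exists Qq : 'M_(m, q),
  [/\ Lp *m Qp = 1%:M, Lq *m Qq = 1%:M &
      forall Y, solution F G Y -> forall k, Lq *m cplx_mx (Y k) = 0 /\
        cplx_mx (Y k) = Qp *m (J ^+ k *m (Lp *m cplx_mx (Y 0%N)))].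
Proof.
have [Lp [Lq [Qq [LpQp LqQq part_id dyn]]]] := weierstrass_coordinates.
exists Lp, Lq, Qq; split => // Y solY.
have step j : Lp *m cplx_mx (Y j.+1) = J *m (Lp *m cplx_mx (Y j)) /\
              H *m (Lq *m cplx_mx (Y j.+1)) = Lq *m cplx_mx (Y j).
  by apply: dyn; rewrite -!map_mxM solY.
have LqY j : Lq *m cplx_mx (Y j) = 0.
  have [h Hh] := wf_nilp wf.
  suff -> : Lq *m cplx_mx (Y j) = H ^+ h *m (Lq *m cplx_mx (Y (h + j)%N)).
    by rewrite Hh mul0mx.
  elim: h {Hh} => [|h ->]; first by rewrite expr0 mul1mx.
  by rewrite -(step (h + j)%N).2 mulmxA exprSr.
move=> k; split => //.
rewrite -[LHS]mul1mx -part_id mulmxDl -!mulmxA LqY mulmx0 addr0.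
congr (_ *m _); elim: k => [|k IH]; first by rewrite expr0 mul1mx.
by rewrite (step k).1 IH mulmxA exprS.
Qed.

Lemma left_block_left_inverse : exists Lp : 'M_(p, m), Lp *m Qp = 1%:M.
Proof. by have [Lp [Lq [Qq []]]] := solution_coordinates; exists Lp. Qed.

(** On the column span of Qp the projection (Qp^* Qp)^-1 Qp^* recovers the
    finite coordinates exactly. *)
Lemma optimal_solution_consistent (Y : nat -> 'cV[R]_m) k :
  solution F G Y -> optimal_solution Qp J (Y 0%N) k = cplx_mx (Y k).
Proof.
move=> solY.
have [Lp [Lq [Qq [LpQp _ /(_ _ solY) YE]]]] := solution_coordinates.
rewrite /optimal_solution (YE k).2 (YE 0%N).2 expr0 mul1mx -!mulmxA.
by rewrite (mulmxA (Qp ^t*)) mulKmx ?(gram_unitmx LpQp)// (mulmxA Lp) LpQp mul1mx.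
Qed.

(** Without an infinite block, P F Q would be the identity. *)
Lemma infinite_block_nonempty : \det F = 0 -> (0 < q)%N.
Proof.
move=> detF; case: (posnP q) => // q0; exfalso.
have PQF : \det (P *m cplx_mx F *m Q) = 0.
  by rewrite !det_mulmx det_map_mx detF rmorph0 mulr0 mul0r.
move: PQF; rewrite (wf_F wf); clear Qp; move: H q0; destruct e => H'.
rewrite castmx_id det_ublock det1 mul1r.
by destruct q => // _; rewrite det_mx00 => /eqP; rewrite oner_eq0.
Qed.

(** If every canonical basis vector were consistent, the infinite coordinates
    would vanish identically, although Lq has a right inverse. *)
Lemma nonconsistent_exists : \det F = 0 -> exists X, ~ consistent F G X.
Proof.
move=> detF; apply/existsNP => allc.
have q0 := infinite_block_nonempty detF.
have [Lp [Lq [Qq [_ LqQq sol]]]] := solution_coordinates.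
have Lq0 : Lq = 0.
  apply/matrixP => a b; have [Y /sol/(_ 0%N)[+ _] Y0] := allc (delta_mx b 0).
  rewrite Y0 /cplx_mx map_delta_mx -colE => /matrixP/(_ a 0).
  by rewrite !mxE.
move: LqQq; rewrite Lq0 mul0mx => /matrixP/(_ (Ordinal q0) (Ordinal q0)).
by rewrite !mxE eqxx => /eqP; rewrite eq_sym oner_eq0.
Qed.

End WeierstrassDynamics.

(** * Consistent and non-consistent initial conditions *)

Section Consistency.
Variables (R : realType) (m : nat) (F G : 'M[R]_m).

Lemma consistentD X Y : consistent F G X -> consistent F G Y ->
  consistent F G (X + Y).
Proof.
move=> [x solx <-] [y soly <-]; exists (x \+ y) => //.
by move=> k /=; rewrite !mulmxDr solx soly.
Qed.

Lemma consistentZ t X : consistent F G X -> consistent F G (t *: X).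
Proof.
move=> [x solx <-]; exists (t \*: x) => //.
by move=> k /=; rewrite -!scalemxAr solx.
Qed.

Lemma consistentN X : consistent F G X -> consistent F G (- X).
Proof. by rewrite -scaleN1r; exact: consistentZ. Qed.

Lemma nonconsistentDZ X Y t : t != 0 -> consistent F G Y ->
  ~ consistent F G X -> ~ consistent F G (Y + t *: X).
Proof.
move=> t0 cY nX cYX; apply: nX.
rewrite -[X](scalerK t0); apply: consistentZ.
by rewrite -[t *: X](addKr Y); apply: consistentD => //; exact: consistentN.
Qed.

(** The complement of a proper subspace spans: a consistent X is
    (X + X0) - X0, any other X is 2 X - X. *)
Lemma nonconsistent_span X0 X : ~ consistent F G X0 ->
  exists X1 X2, [/\ ~ consistent F G X1, ~ consistent F G X2 & X = X1 - X2].
Proof.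
move=> nX0; have [cX|nX] := pselect (consistent F G X).
  exists (X + 1 *: X0), X0; split => //; last by rewrite scale1r addrK.
  exact: nonconsistentDZ (oner_neq0 _) cX nX0.
exists (2 *: X), X; split => //; last by rewrite scaler_nat addrK.
by move=> /(consistentZ 2^-1); rewrite scalerK// pnatr_eq0.
Qed.

End Consistency.

Lemma complex_vector_parts (R : realType) (m : nat) (y : 'cV[R[i]]_m) :
  exists X1 X2 : 'cV[R]_m, y = cplx_mx X1 + 'i%C *: cplx_mx X2.
Proof.
exists (map_mx (@complex.Re R) y), (map_mx (@complex.Im R) y).
by apply/matrixP => a b; rewrite !mxE; exact: complexE.
Qed.

(** * Stability and power-boundedness *)

Theorem theorem3p1 (R : realType) (m : nat) (F G : 'M[R]_m)
    (detF : \det F = 0) (regFG : regular_pencil F G)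
    (p q : nat) (e : (p + q)%N = m)
    (P Q : 'M[R[i]]_m) (J : 'M[R[i]]_p) (H : 'M[R[i]]_q)
    (wf : weierstrass_form e F G P Q J H)
    (N : forall n : nat, 'cV[R[i]]_n -> R)
    (normN : forall n : nat, vector_norm (@N n))
    (Ys : 'cV[R]_m) (eqYs : equilibria F G Ys) :
  lyapunov_stable F G (left_block e Q) J (@N m) Ys <->
  exists2 c : R, 0 < c & forall k : nat, induced_norm (@N p) (J ^+ k) <= c.
Proof.
pose Qp := left_block e Q; pose S := invmx (Qp ^t* *m Qp) *m Qp ^t*.
have [Lp LpQp] := left_block_left_inverse wf.
have SQp : S *m Qp = 1%:M by rewrite -mulmxA mulVmx// (gram_unitmx LpQp).
have optE X k : optimal_solution Qp J X k = Qp *m (J ^+ k *m (S *m cplx_mx X)).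
  by rewrite /optimal_solution -!mulmxA.
have [consYs fixYs] := eqYs.
have optYs k : optimal_solution Qp J Ys k = cplx_mx Ys.
  have [Y solY Y0] := consYs.
  rewrite -{1}Y0 (optimal_solution_consistent wf k solY).
  by case: k => [|k]; rewrite ?Y0// (fixYs Y).
have optB X k : optimal_solution Qp J X k - cplx_mx Ys =
    Qp *m (J ^+ k *m (S *m cplx_mx (X - Ys))).
  by rewrite -{1}(optYs k) !optE -!mulmxBr /cplx_mx map_mxB.
split=> [stab|[c c0 Jc] eps eps0].
- have bnd_nc X : ~ consistent F G X ->
      exists B, forall k, N m (Qp *m (J ^+ k *m (S *m cplx_mx X))) <= B.
    move=> nX; have [delta delta0 stabd] := stab 1 ltr01.
    (* The scaling brings Ys + t X within delta of Ys; the added 1 keeps the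
       denominator positive. *)
    pose t := delta / (1 + N m (cplx_mx X)).
    have den0 : 0 < 1 + N m (cplx_mx X) by rewrite ltr_pwDl// vnorm_ge0.
    have t0 : 0 < t by rewrite divr_gt0.
    exists t^-1 => k; rewrite -[t^-1]mulr1 ler_pdivlMl//.
    have tXE : cplx_mx (Ys + t *: X - Ys) = t%:C *: cplx_mx X.
      by rewrite addrC addKr /cplx_mx map_mxZ.
    have := stabd (Ys + t *: X) (nonconsistentDZ (lt0r_neq0 t0) consYs nX).
    rewrite tXE vnormZr// gtr0_norm// mulrAC ler_pdivrMr// ler_pM2l//.
    rewrite lerDr => /(_ ler01 k).
    by rewrite optB tXE -!scalemxAr vnormZr// gtr0_norm.
  have [X0 nX0] := nonconsistent_exists wf detF.
  have bnd_real X :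
      exists B, forall k, N m (Qp *m (J ^+ k *m (S *m cplx_mx X))) <= B.
    have [X1 [X2 [/bnd_nc[B1 HB1] /bnd_nc[B2 HB2] ->]]] := nonconsistent_span X nX0.
    exists (B1 + B2) => k; rewrite /cplx_mx map_mxB !mulmxBr.
    by rewrite (le_trans (vnormD (normN m) _ _))// vnormN// lerD.
  have [D D0 HD] := mulmx_bounded Lp (normN m) (normN p).
  have bnd v : exists B, forall k, N p (J ^+ k *m v) <= B.
    have [X1 [X2 vE]] := complex_vector_parts (Qp *m v).
    have [[B1 HB1] [B2 HB2]] := (bnd_real X1, bnd_real X2).
    exists (D * (B1 + B2)) => k.
    (* J^k v = Lp (Qp J^k S (Qp v)), and Qp v is split into real and imaginary
       parts. *)
    rewrite -[_ *m v]mul1mx -LpQp -mulmxA (le_trans (HD _))// ler_pM2l//.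
    rewrite -{1}[v]mul1mx -SQp -mulmxA vE !mulmxDr -!scalemxAr.
    rewrite (le_trans (vnormD (normN m) _ _))// lerD//.
    by rewrite vnormZ//= expr0n expr1n add0r sqrtr1 mul1r.
  have [C C0 HC] := pointwise_bounded_uniform (normN p) (normN p) bnd.
  by exists C => // k; apply: induced_norm_le => //; exact: ltW.
- have [D D0 HD] := mulmx_bounded Qp (normN p) (normN m).
  have [E E0 HE] := mulmx_bounded S (normN m) (normN p).
  exists (eps / (D * (c * E))); first by rewrite divr_gt0// !mulr_gt0.
  move=> Y0 _ Y0d k; rewrite optB.
  rewrite ler_pdivlMr ?mulr_gt0// in Y0d.
  apply: le_trans (HD _) (le_trans _ Y0d).
  rewrite [leRHS]mulrC -!mulrA ler_pM2l//.
  apply: le_trans (le_induced_norm _ _ (normN p)) _.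
  apply: le_trans (_ : c * N p (S *m cplx_mx (Y0 - Ys)) <= _).
    by rewrite ler_wpM2r// vnorm_ge0.
  by rewrite ler_pM2l.
Qed.
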